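(* Suppose that $\mathcal{C}\subseteq L^0_c$ is solid and $\mathcal{P}$-sensitive. Let $\mathcal{Q}\subseteq\mathfrak{P}_c(\Omega)$ be a reduction set for $\mathcal{C}$. Then the following are equivalent: 1. $\mathcal{C}$ is sequentially order closed. 2. $\mathcal{C}$ is $\mathcal{Q}$-closed. 3. $\mathcal{C}$ is locally $Q$-closed for each $Q\in\mathcal{Q}$. 4. $j_Q(\mathcal{C})$ is $Q$-closed in $L^0_Q$ for each $Q\in\mathcal{Q}$. 5. $j_Q(\mathcal{C})$ is order closed with respect to the $Q$-a.s. order on $L^0_Q$ for each $Q\in\mathcal{Q}$. 6. $j_Q(\mathcal{C})$ is sequentially order closed with respect to the $Q$-a.s. order on $L^0_Q$ for each $Q\in\mathcal{Q}$.
   Context: $(\Omega,\mathcal{F})$ is an arbitrary measurable space, $\mathfrak{P}(\Omega)$ the set of probability measures on it, and $\mathcal{P}\subseteq\mathfrak{P}(\Omega)$ a fixed non-empty set. Put $c[A]:=\sup_{P\in\mathcal{P}}P[A]$, $A\in\mathcal{F}$. An event $A$ is $\mathcal{P}$-polar if $c[A]=0$; a property holds $\mathcal{P}$-q.s. if it holds outside a $\mathcal{P}$-polar event. $\mathfrak{P}_c(\Omega)$ is the set of $Q\in\mathfrak{P}(\Omega)$ with $Q[N]=0$ for every $\mathcal{P}$-polar $N$. $L^0_c$ is the space of real-valued random variables on $(\Omega,\mathcal{F})$ modulo $\mathcal{P}$-q.s. equality, ordered by $X\preccurlyeq Y$ iff $X\le Y$ $\mathcal{P}$-q.s.; $L^0_{c+}$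 is its positive cone. For $Q\in\mathfrak{P}_c(\Omega)$, $L^0_Q$ denotes random variables modulo $Q$-a.s. equality with the $Q$-a.s. order, and $j_Q:L^0_c\to L^0_Q$ maps the $\mathcal{P}$-q.s. class of $f$ to its $Q$-a.s. class. $\mathcal{C}\subseteq L^0_c$ is $\mathcal{P}$-sensitive if $\mathcal{C}=\bigcap_{Q\in\mathfrak{P}_c(\Omega)}j_Q^{-1}(j_Q(\mathcal{C}))$. A non-empty $\mathcal{Q}\subseteq\mathfrak{P}_c(\Omega)$ is a reduction set for $\mathcal{C}$ if $\mathcal{C}=\bigcap_{Q\in\mathcal{Q}}j_Q^{-1}(j_Q(\mathcal{C}))$. $\mathcal{C}$ is solid in $L^0_c$ if $X\in\mathcal{C}$, $Y\in L^0_c$, $|Y|\preccurlyeq|X|$ imply $Y\in\mathcal{C}$; it is solid in $L^0_{c+}$ if $\mathcal{C}\subseteq L^0_{c+}$ and $X\in\mathcal{C}$, $Y\in L^0_{c+}$, $Y\preccurlyeq X$ imply $Y\in\mathcal{C}$. ''Solid'' means solid in $L^0_c$ or solid in $L^0_{c+}$. A net $(X_\alpha)_{\alpha\in I}\subset L^0_c$ is order convergent to $X\in L^0_c$ if there is a decreasing net $(Y_\alpha)_{\alpha\in I}\subset L^0_c$ with the same index set, $\inf_\alpha Y_\alpha=0$ (greatest lower bound in $L^0_c$), and $|X_\alpha-X|\preccurlyeq Y_\alpha$ for all $\alpha$. A set is order closed if it contains all its limits (in the ambient space) of order convergent nets of its elements, and sequentially order closed if this holds for sequences. The same definitions apply to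 $L^0_Q$ with the $Q$-a.s. order. $\mathcal{C}\subseteq L^0_c$ is $\mathcal{Q}$-closed if whenever $(X_n)_{n\in\mathbb{N}}\subseteq\mathcal{C}$ and $X\in L^0_c$ satisfy $X_n\to X$ in $Q$-probability for every $Q\in\mathcal{Q}$, then $X\in\mathcal{C}$. $\mathcal{C}$ is locally $Q$-closed if for each sequence $(X_n)\subseteq\mathcal{C}$ and $X\in L^0_c$ with $X_n\to X$ in $Q$-probability there is $Y\in\mathcal{C}$ with $j_Q(X)=j_Q(Y)$. A subset of $L^0_Q$ is $Q$-closed if it is closed under convergence in $Q$-probability. *)

(* Defs.v *)
From HB Require Import structures.
From mathcomp Require Import all_boot all_order all_algebra.
From mathcomp Require Import generic_quotient ring_quotient.
From mathcomp Require Import all_classical all_reals all_analysis.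
From mathcomp Require Import measurable_realfun.

Set Implicit Arguments.
Unset Strict Implicit.
Unset Printing Implicit Defensive.

Import Order.TTheory GRing.Theory Num.Theory.
Import numFieldNormedType.Exports.

Local Open Scope classical_set_scope.
Local Open Scope ring_scope.
Local Open Scope quotient_scope.

Section capacity.
Context d (T : measurableType d) (R : realType).
Variable PP : set (probability T R).

(* c[A] is taken as a real supremum, which makes sense because P A <= 1. Since
   sup set0 = 0, every definition below is meaningful also when PP is empty. *)
Definition capacity (A : set T) : R := sup [set fine (P A) | P in PP].

Definition polar (N : set T) : Prop := measurable N /\ capacity N = 0.

Definition qs (A : T -> Prop) : Prop :=
  exists2 N, polar N & forall w, ~ N w -> A w.

Definition Pc : set (probability T R) :=
  [set Q | forall N, polar N -> Q N = 0%E].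

Lemma polarP N : polar N <-> measurable N /\ forall P, PP P -> P N = 0%E.
Proof.
have fin (P : probability T R) A : measurable A -> P A \is a fin_num.
  by move=> mA; exact: fin_num_measure.
split=> -[mN]; last first.
  move=> N0; split=> //; rewrite /capacity.
  have [->|/set0P[P0 PP0]] := eqVneq PP set0; first by rewrite image_set0 sup0.
  suff -> : [set fine (P N) | P in PP] = [set 0] by rewrite sup1.
  apply/seteqP; split=> [_ [P PPP <-]|_ ->] /=; first by rewrite N0.
  by exists P0; rewrite ?N0.
move=> c0; split=> // P PPP.
rewrite -(fineK (fin P N mN)); congr EFin; apply/eqP.
rewrite eq_le fine_ge0 ?measure_ge0// andbT -c0.
apply: ub_le_sup; last by exists P.
exists 1 => _ [P' _ <-]; rewrite -lee_fin fineK ?fin//.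
exact: probability_le1.
Qed.

Lemma polarU M N : polar M -> polar N -> polar (M `|` N).
Proof.
move=> /polarP[mM M0] /polarP[mN N0]; apply/polarP; split.
  exact: measurableU.
move=> P PPP; apply/eqP; rewrite eq_le measure_ge0 andbT.
apply: le_trans (measureU2 _ mM mN) _.
by rewrite [X in (X + _)%E](M0 _ PPP) [X in (_ + X)%E](N0 _ PPP) add0e.
Qed.

Lemma qsT (A : T -> Prop) : (forall w, A w) -> qs A.
Proof.
by move=> AT; exists set0 => //; apply/polarP; split=> // P _; rewrite measure0.
Qed.

Lemma qs_imply (A B : T -> Prop) : (forall w, A w -> B w) -> qs A -> qs B.
Proof. by move=> AB [N pN NA]; exists N => // w /NA /AB. Qed.

Lemma qsI (A B : T -> Prop) : qs A -> qs B -> qs (fun w => A w /\ B w).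
Proof.
move=> [M pM MA] [N pN NB]; exists (M `|` N); first exact: polarU.
by move=> w /not_orP[/MA ? /NB ?].
Qed.

End capacity.

Section L0.
Context d (T : measurableType d) (R : realType).
Variable PP : set (probability T R).
Implicit Types f g h : {mfun T >-> R}.

Definition qs_eq f g : bool := `[< qs PP (fun w => f w = g w) >].

Let qs_eq_refl : reflexive qs_eq.
Proof. by move=> f; apply/asboolP/qsT. Qed.

Let qs_eq_sym : symmetric qs_eq.
Proof.
by move=> f g; apply/asboolP/asboolP; apply: qs_imply => w ->.
Qed.

Let qs_eq_trans : transitive qs_eq.
Proof.
move=> g f h /asboolP fg /asboolP gh; apply/asboolP.
by apply: qs_imply (qsI fg gh) => w [-> ->].
Qed.

Canonical qs_eq_canonical := EquivRel qs_eq qs_eq_refl qs_eq_sym qs_eq_trans.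

Definition L0 : Type := {eq_quot qs_eq}.
HB.instance Definition _ := Choice.on L0.
HB.instance Definition _ := EqQuotient.on L0.

Lemma pi_eqP f g : \pi_L0 f = \pi_L0 g <-> qs PP (fun w => f w = g w).
Proof.
split=> [/eqP|fg]; first by rewrite eqmodE => /asboolP.
by apply/eqP; rewrite eqmodE; apply/asboolP.
Qed.

Lemma repr_pi f : qs PP (fun w => repr (\pi_L0 f) w = f w).
Proof. by apply/pi_eqP; rewrite reprK. Qed.

Definition L0_zero : L0 := \pi_L0 0.
Definition L0_opp (X : L0) : L0 := \pi_L0 (- repr X).
Definition L0_add (X Y : L0) : L0 := \pi_L0 (repr X + repr Y).

Definition mabs f : {mfun T >-> R} := (@Num.norm R R \o f)%FUN.
Definition L0_abs (X : L0) : L0 := \pi_L0 (mabs (repr X)).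

Definition L0_le (X Y : L0) : bool := `[< qs PP (fun w => repr X w <= repr Y w) >].

Lemma pi_opp f : L0_opp (\pi_L0 f) = \pi_L0 (- f).
Proof.
apply/pi_eqP; apply: qs_imply (repr_pi f) => w fw.
by change (- (repr (\pi_L0 f) w) = - f w); rewrite fw.
Qed.

Lemma pi_add f g : L0_add (\pi_L0 f) (\pi_L0 g) = \pi_L0 (f + g).
Proof.
apply/pi_eqP; apply: qs_imply (qsI (repr_pi f) (repr_pi g)) => w [fw gw].
change (repr (\pi_L0 f) w + repr (\pi_L0 g) w = f w + g w).
by rewrite fw gw.
Qed.

Lemma pi_abs f : L0_abs (\pi_L0 f) = \pi_L0 (mabs f).
Proof. by apply/pi_eqP; apply: qs_imply (repr_pi f) => w /= ->. Qed.

Let L0_addA : associative L0_add.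
Proof.
elim/quotW=> f; elim/quotW=> g; elim/quotW=> h.
by rewrite (pi_add g h) (pi_add f g) (pi_add f) (pi_add _ h) addrA.
Qed.

Let L0_addC : commutative L0_add.
Proof.
elim/quotW=> f; elim/quotW=> g.
by rewrite (pi_add f g) (pi_add g f) addrC.
Qed.

Let L0_add0 : left_id L0_zero L0_add.
Proof. by elim/quotW=> f; rewrite (pi_add 0 f) add0r. Qed.

Let L0_addN : left_inverse L0_zero L0_opp L0_add.
Proof. by elim/quotW=> f; rewrite (pi_opp f) (pi_add _ f) addNr. Qed.

HB.instance Definition _ :=
  GRing.isZmodule.Build L0 L0_addA L0_addC L0_add0 L0_addN.

Let L0_le_refl : reflexive L0_le.
Proof. by move=> X; apply/asboolP/qsT. Qed.

Let L0_le_anti : antisymmetric L0_le.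
Proof.
move=> X Y /andP[/asboolP XY /asboolP YX]; rewrite -[X]reprK -[Y]reprK.
apply/pi_eqP; apply: qs_imply (qsI XY YX) => w [? ?].
by apply/eqP; rewrite eq_le; apply/andP.
Qed.

Let L0_le_trans : transitive L0_le.
Proof.
move=> Y X Z /asboolP XY /asboolP YZ; apply/asboolP.
by apply: qs_imply (qsI XY YZ) => w [/le_trans]; exact.
Qed.

HB.instance Definition _ :=
  Order.Le_isPOrder.Build ring_display L0 L0_le_refl L0_le_anti L0_le_trans.

Lemma pi_le f g : \pi_L0 f <= \pi_L0 g <-> qs PP (fun w => f w <= g w).
Proof.
have fg := qsI (repr_pi f) (repr_pi g).
split=> [/asboolP le_fg|le_fg]; last apply/asboolP.
  by apply: qs_imply (qsI fg le_fg) => w [[-> ->]].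
by apply: qs_imply (qsI fg le_fg) => w [[-> ->]].
Qed.

Definition L0_pos : set L0 := [set X | 0 <= X].

Definition solid_in_L0 (C : set L0) : Prop :=
  forall X Y, C X -> L0_abs Y <= L0_abs X -> C Y.

Definition solid_in_L0_pos (C : set L0) : Prop :=
  C `<=` L0_pos /\ forall X Y, C X -> L0_pos Y -> Y <= X -> C Y.

Definition solid (C : set L0) : Prop := solid_in_L0 C \/ solid_in_L0_pos C.

Definition directed (I : Type) (leI : I -> I -> Prop) : Prop :=
  [/\ inhabited I, (forall a, leI a a),
      (forall a b c, leI a b -> leI b c -> leI a c)
    & (forall a b, exists2 c, leI a c & leI b c)].

Definition order_cvg (I : Type) (leI : I -> I -> Prop) (X_ : I -> L0) (X : L0)
    : Prop :=
  exists Y_ : I -> L0,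
    [/\ (forall a b, leI a b -> Y_ b <= Y_ a),
        infimums (range Y_) 0
      & forall a, L0_abs (X_ a - X) <= Y_ a].

Definition order_closed (C : set L0) : Prop :=
  forall (I : Type) (leI : I -> I -> Prop) (X_ : I -> L0) (X : L0),
    directed leI -> (forall a, C (X_ a)) -> order_cvg leI X_ X -> C X.

Definition seq_order_closed (C : set L0) : Prop :=
  forall (X_ : nat -> L0) (X : L0),
    (forall n, C (X_ n)) -> order_cvg (fun m n => (m <= n)%N) X_ X -> C X.

Definition cvg_in_probability (Q : probability T R) (X_ : nat -> L0) (X : L0)
    : Prop :=
  forall e : R, 0 < e ->
    Q [set w | e <= `|repr (X_ n) w - repr X w|] @[n --> \oo] --> 0%E.

Definition closed_in_probability (QQ : set (probability T R)) (C : set L0)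
    : Prop :=
  forall (X_ : nat -> L0) (X : L0), (forall n, C (X_ n)) ->
    (forall Q, QQ Q -> cvg_in_probability Q X_ X) -> C X.

End L0.

(* The space L^0_Q is L0 [set Q], as (lemma qs_set1) a property holds
   q.s. with respect to {Q} if and only if it holds Q-almost surely. *)
Notation L0Q Q := (L0 [set Q]).

Section jQ.
Context d (T : measurableType d) (R : realType).
Variables (PP : set (probability T R)).

Definition j (Q : probability T R) (X : L0 PP) : L0Q Q := \pi_(L0Q Q) (repr X).

Definition reduced_by (QQ : set (probability T R)) (C : set (L0 PP)) : Prop :=
  C = \bigcap_(Q in QQ) (j Q @^-1` (j Q @` C)).

Definition sensitive (C : set (L0 PP)) : Prop := reduced_by (Pc PP) C.

Definition reduction_set (QQ : set (probability T R)) (C : set (L0 PP)) : Prop :=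
  [/\ QQ !=set0, QQ `<=` Pc PP & reduced_by QQ C].

Definition locally_closed (Q : probability T R) (C : set (L0 PP)) : Prop :=
  forall (X_ : nat -> L0 PP) (X : L0 PP), (forall n, C (X_ n)) ->
    cvg_in_probability Q X_ X -> exists2 Y, C Y & j Q X = j Q Y.

Lemma qs_set1 (Q : probability T R) (A : T -> Prop) :
  qs [set Q] A <-> {ae Q, forall w, A w}.
Proof.
split=> [[N /polarP[mN N0] NA]|[N [mN N0 AN]]].
  exists N; split; [exact: mN|exact: N0|].
  by move=> w /= nA; apply: contrapT => /NA.
exists N; first by apply/polarP; split=> // _ ->.
by move=> w nN; apply: contrapT => nA; exact/nN/AN.
Qed.

Lemma qs_ae (Q : probability T R) (A : T -> Prop) :
  Pc PP Q -> qs PP A -> qs [set Q] A.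
Proof.
move=> PcQ [N pN NA]; exists N => //; apply/polarP; split; first by case: pN.
by move=> _ ->; exact: PcQ.
Qed.

Lemma j_pi (Q : probability T R) (f : {mfun T >-> R}) :
  Pc PP Q -> j Q (\pi_(L0 PP) f) = \pi_(L0Q Q) f.
Proof. by move=> PcQ; apply/pi_eqP; exact: qs_ae (repr_pi _ f). Qed.

Lemma cvg_in_probability_pi (Q : probability T R) (f_ : nat -> {mfun T >-> R})
    (f : {mfun T >-> R}) : Pc PP Q ->
  cvg_in_probability Q (fun n => \pi_(L0 PP) (f_ n)) (\pi_(L0 PP) f) <->
  forall e : R, 0 < e ->
    Q [set w | e <= `|f_ n w - f w|] @[n --> \oo] --> 0%E.
Proof.
move=> PcQ.
have m (g h : {mfun T >-> R}) (e : R) : measurable [set w | e <= `|g w - h w|].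
  rewrite (_ : [set _ | _] = mabs (g - h) @^-1` `[e, +oo[); last first.
    by apply/seteqP; split=> w /=; rewrite in_itv/= andbT.
  by rewrite -[X in measurable X]setTI; exact: measurable_funP.
have E e n : Q [set w | e <= `|repr (\pi_(L0 PP) (f_ n)) w
    - repr (\pi_(L0 PP) f) w|] = Q [set w | e <= `|f_ n w - f w|].
  have [N pN fN] := qsI (repr_pi PP (f_ n)) (repr_pi PP f).
  have [mN _] := pN.
  have QN (A : set T) : measurable A -> Q A = Q (A `\` N).
    move=> mA; have mAN : measurable (A `\` N) by exact: measurableD.
    apply/eqP; rewrite eq_le; apply/andP; split; last first.
      by apply: le_measure; rewrite ?inE// => w [].
    have -> : Q (A `\` N) = (Q (A `\` N) + Q N)%E.
      by rewrite [X in (_ + X)%E](PcQ _ pN) adde0.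
    apply: le_trans (measureU2 _ mAN mN).
    apply: le_measure; rewrite ?inE//; first exact: measurableU.
    move=> w Aw; have [Nw|nNw] := pselect (N w); [by right|by left].
  rewrite QN; last exact: m.
  rewrite [RHS]QN; last exact: m.
  congr (Q _); apply/seteqP.
  by split=> w /= [le_e nN]; split=> //; move: le_e; have [-> ->] := fN w nN.
split=> H e e0; have := H e e0; first by under eq_fun do rewrite /= E.
by rewrite -(funext (E e)).
Qed.

End jQ.

(* Main.v *)
From HB Require Import structures.
Require Import Defs.
From mathcomp Require Import all_boot all_order all_algebra.
From mathcomp Require Import all_classical all_reals all_analysis.
From mathcomp Require Import generic_quotient measurable_realfun.

(* If X_n in C converges in Q-probability, a subsequence converges outside a
   Q-null set N (Borel-Cantelli); by solidity its restriction to the complement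
   of N stays in C, and it converges at every point, hence in order and in
   probability under every measure, to a limit with the same image under j Q.
   This gives 1 => 2 => 3, where membership in C is tested on the reduction set.
   For 4 => 5, a net decreasing to 0 in L0_Q contains a sequence tending to 0 in
   Q-probability, and for 6 => 1 countable infima are computed pointwise, so
   that j Q preserves order convergence of sequences. *)

Set Implicit Arguments.
Unset Strict Implicit.
Unset Printing Implicit Defensive.

Import Order.TTheory GRing.Theory Num.Theory.
Import numFieldNormedType.Exports.

Local Open Scope classical_set_scope.
Local Open Scope ring_scope.
Local Open Scope quotient_scope.

(** * Measurable functions, Borel-Cantelli and modes of convergence *)

Section real_random_variables.
Context d (T : measurableType d) (R : realType).
Implicit Types f g h : {mfun T >-> R}.

(** Lets pointwise suprema and infima serve as representatives of classes. *)
Lemma mfun_ex (f : T -> R) : measurable_fun setT f ->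
  exists g : {mfun T >-> R}, g =1 f.
Proof.
move=> mf; pose b := isMeasurableFun.Build _ _ _ _ f mf.
by exists (HB.pack f b : {mfun T >-> R}).
Qed.

Lemma measurable_mfun_ge (f : {mfun T >-> R}) (e : R) :
  measurable [set w | e <= f w].
Proof.
rewrite (_ : [set _ | _] = f @^-1` `[e, +oo[); last first.
  by apply/seteqP; split=> w /=; rewrite in_itv/= andbT.
by rewrite -[X in measurable X]setTI; exact: measurable_funP.
Qed.

Lemma measurable_mfun_dist_ge f g (e : R) :
  measurable [set w | e <= `|f w - g w|].
Proof. exact: (measurable_mfun_ge (mabs (f - g)) e). Qed.

Definition trunc (A : set T) (mA : measurable A) f : {mfun T >-> R} :=
  f * indic_mfun A mA.

Lemma truncE A (mA : measurable A) f w :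
  trunc mA f w = if w \in A then f w else 0.
Proof.
rewrite /trunc; change (f w * \1_A w = if w \in A then f w else 0).
by rewrite indicE; case: ifP; rewrite (mulr1, mulr0).
Qed.

Lemma measurable_lim_sup_set (F : nat -> set T) :
  (forall n, measurable (F n)) -> measurable (lim_sup_set F).
Proof.
by move=> mF; apply: bigcap_measurable => // n _; apply: bigcup_measurable => *.
Qed.

(** Borel-Cantelli: the bounds sum to 1. *)
Lemma lim_sup_set_half0 (Q : probability T R) (F : nat -> set T) :
  (forall n, measurable (F n)) ->
  (forall n, (Q (F n) <= (1 / (2 ^ (n + 1))%:R)%:E)%E) ->
  Q (lim_sup_set F) = 0%E.
Proof.
move=> mF QF; apply: lim_sup_set_cvg0 => //.
apply: (@le_lt_trans _ _ (\sum_(0 <= n <oo) (1 / (2 ^ (n + 1))%:R)%:E)%E).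
  by apply: lee_nneseries => // n _; exact: QF.
by rewrite (cvg_lim _ (@cvg_geometric_eseries_half R 1 0%N))// ltry.
Qed.

(** Continuity from above along the decreasing tail unions. *)
Lemma probability_lim_sup_set_cvg (Q : probability T R) (F : nat -> set T) :
  (forall n, measurable (F n)) ->
  Q (\bigcup_(k >= n) F k) @[n --> \oo] --> Q (lim_sup_set F).
Proof.
move=> mF; apply: lim_sup_set_cvg => //.
apply: le_lt_trans (probability_le1 _ _) (ltry _).
by apply: bigcup_measurable => *; exact: mF.
Qed.

(** The limsup of the events of deviation at least [e] is empty, so the probabilities of their tail
    unions tend to 0. *)
Lemma pointwise_cvg_in_probability (Q : probability T R)
    (f_ : nat -> {mfun T >-> R}) f :
  (forall w, f_ n w @[n --> \oo] --> f w) ->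
  forall e : R, 0 < e -> Q [set w | e <= `|f_ n w - f w|] @[n --> \oo] --> 0%E.
Proof.
move=> ff e e0.
pose F n := [set w | e <= `|f_ n w - f w|].
have mF n : measurable (F n) by exact: measurable_mfun_dist_ge.
have F0 : lim_sup_set F = set0.
  rewrite -subset0 => w Fw.
  have /cvgrPdist_lt/(_ e e0)[n _ fn] := ff w.
  have [k /= nk] := Fw n I; rewrite /F/= leNgt => /negP; apply.
  by rewrite distrC; exact: fn.
have := @probability_lim_sup_set_cvg Q _ mF.
rewrite F0 measure0; apply: (squeeze_cvge _ (cvg_cst 0%E)).
near=> n; rewrite measure_ge0/=.
apply: le_measure; rewrite ?inE; first exact: mF.
  by apply: bigcup_measurable => *; exact: mF.
by move=> w Fw; exists n => /=.
Unshelve. all: by end_near. Qed.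

(** Index [s n] is chosen so that a deviation of at least 1/(n+1) has probability below 2^-(n+1);
    the null set is the limsup of these events. The map [s] only selects indices and may fail to be
    increasing. *)
Lemma ae_cvg_subsequence (Q : probability T R)
    (f_ : nat -> {mfun T >-> R}) f :
  (forall e : R, 0 < e ->
    Q [set w | e <= `|f_ n w - f w|] @[n --> \oo] --> 0%E) ->
  exists s : nat -> nat, exists2 N, measurable N /\ Q N = 0%E &
    forall w, ~ N w -> f_ (s n) w @[n --> \oo] --> f w.
Proof.
move=> ff.
have /choice[s sP] n : exists k, (Q [set w | (n.+1%:R^-1 <= `|f_ k w - f w|)%R]
    < (1 / (2 ^ (n + 1))%:R)%:E)%E.
  have n0 : (0 : R) < n.+1%:R^-1 by rewrite invr_gt0.
  have p0 : (0 : R) < 1 / (2 ^ (n + 1))%:R.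
    by rewrite divr_gt0// ltr0n expn_gt0.
  have /fine_cvgP[fin /cvgrPdist_lt/(_ _ p0) near_lt] := ff _ n0.
  have [k _ /(_ k (leqnn k))[fink]] := filterI fin near_lt.
  rewrite /= sub0r normrN => ltk; exists k.
  rewrite -[X in (X < _)%E]fineK// lte_fin.
  exact: le_lt_trans (ler_norm _) ltk.
pose F n := [set w | n.+1%:R^-1 <= `|f_ (s n) w - f w|].
have mF n : measurable (F n) by exact: measurable_mfun_dist_ge.
exists s; exists (lim_sup_set F); first split.
- exact: measurable_lim_sup_set.
- by apply: lim_sup_set_half0 => // n; exact/ltW/sP.
- move=> w /existsNP[m] /not_implyP[_ Fm].
  apply/cvgrPdist_lt => e e0; near=> n.
  rewrite distrC; apply: (@lt_trans _ _ (n.+1%:R^-1)); last first.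
    by near: n; exact: near_infty_natSinv_lt (PosNum e0).
  rewrite ltNge; apply/negP => Fn; apply: Fm; exists n => //=.
  by near: n; exact: nbhs_infty_ge.
Unshelve. all: by end_near. Qed.

End real_random_variables.

(** * Quasi-sure order, solid sets and pointwise limits *)

Section quasi_sure.
Context d (T : measurableType d) (R : realType) (PP : set (probability T R)).
Implicit Types (f g h : {mfun T >-> R}) (C : set (L0 PP)).

Lemma polar_bigcup (N : nat -> set T) :
  (forall n, polar PP (N n)) -> polar PP (\bigcup_n N n).
Proof.
move=> pN; apply/polarP; split.
  by apply: bigcup_measurable => n _; have [] := pN n.
move=> P PPP; apply: measure_negligible.
  by apply: bigcup_measurable => n _; have [] := pN n.
apply: negligible_bigcup => n; have /polarP[mN N0] := pN n.
by apply/negligibleP => //; exact: N0.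
Qed.

Lemma qs_forall (A : nat -> T -> Prop) :
  (forall n, qs PP (A n)) -> qs PP (fun w => forall n, A n w).
Proof.
move=> qA; have /choice[N NP] n :
    exists N, polar PP N /\ forall w, ~ N w -> A n w.
  by have [N] := qA n; exists N.
exists (\bigcup_n N n); first by apply: polar_bigcup => n; case: (NP n).
by move=> w nN n; apply: (NP n).2 => Nw; apply: nN; exists n.
Qed.

Lemma L0_leP (X Y : L0 PP) : X <= Y <-> qs PP (fun w => repr X w <= repr Y w).
Proof. by split => /asboolP. Qed.

Lemma L0_pi_ge0 f : 0 <= \pi_(L0 PP) f <-> qs PP (fun w => 0 <= f w).
Proof. exact: (pi_le PP 0 f). Qed.

Lemma L0_pi_le0 f : \pi_(L0 PP) f <= 0 <-> qs PP (fun w => f w <= 0).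
Proof. exact: (pi_le PP f 0). Qed.

Lemma L0_dist_le f g h :
  L0_abs (\pi_(L0 PP) f - \pi_(L0 PP) g) <= \pi_(L0 PP) h <->
  qs PP (fun w => `|f w - g w| <= h w).
Proof.
rewrite -[_ - _]/(L0_add _ (L0_opp _)) Defs.pi_opp Defs.pi_add pi_abs.
exact: pi_le.
Qed.

(** Moves greatest lower bounds from classes to representatives, where they can be studied
    pointwise. *)
Lemma L0_infimum0 (Y_ : nat -> {mfun T >-> R}) :
  infimums (range (fun n => \pi_(L0 PP) (Y_ n))) 0 <->
  (forall n, qs PP (fun w => 0 <= Y_ n w)) /\
  (forall h, (forall n, qs PP (fun w => h w <= Y_ n w)) ->
    qs PP (fun w => h w <= 0)).
Proof.
split=> [[lb0 glb]|[Y0 Yle0]]; split.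
- by move=> n; apply/L0_pi_ge0/lb0; exists n.
- move=> h hY; apply/L0_pi_le0/glb => _ [n _ <-]; exact/pi_le.
- by move=> _ [n _ <-]; exact/L0_pi_ge0.
- move=> Z; rewrite -[Z]reprK => ZY; apply/L0_pi_le0/Yle0 => n.
  by apply/pi_le/ZY; exists n.
Qed.

Lemma trunc_solid C (solidC : solid C) (A : set T) (mA : measurable A) f :
  C (\pi_(L0 PP) f) -> C (\pi_(L0 PP) (trunc mA f)).
Proof.
move=> Cf; case: solidC => [solidC|[Cpos solidC]].
  apply: solidC Cf _; rewrite !pi_abs; apply/pi_le/qsT => w.
  change (`|trunc mA f w| <= `|f w|).
  by rewrite truncE; case: ifP => // _; rewrite normr0.
(* In the positive cone, [f >= 0] q.s. gives [0 <= trunc mA f <= f] q.s. *)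
have /L0_pi_ge0 f0 := Cpos _ Cf.
apply: solidC Cf _ _; first apply/L0_pi_ge0; last apply/pi_le.
  by apply: qs_imply f0 => w f0; rewrite truncE; case: ifP.
by apply: qs_imply f0 => w f0; rewrite truncE; case: ifP.
Qed.

(** The dominating sequence is the supremum of [|f_ k - f|] over [k >= n]: it decreases to 0 at
    every point, so a lower bound of its classes is at most 0 q.s. *)
Lemma pointwise_order_cvg (f_ : nat -> {mfun T >-> R}) f :
  (forall w, f_ n w @[n --> \oo] --> f w) ->
  order_cvg (fun m n => (m <= n)%N)
    (fun n => \pi_(L0 PP) (f_ n)) (\pi_(L0 PP) f).
Proof.
move=> ff.
pose u w n := `|f_ n w - f w|.
have u0 w : u w @ \oo --> (0 : R^o).
  rewrite /u -[X in _ --> X](normr0 R) -(subrr (f w)).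
  by apply: cvg_norm; apply: cvgB => //; exact: cvg_cst.
(* Boundedness makes the real suprema genuine rather than default values. *)
have ubu w : has_ubound (range (u w)).
  have [M uM] : has_ubound [set `|u w n| | n in setT].
    by apply: cvg_has_ub; apply/cvg_ex; exists 0; exact: u0.
  by exists M => _ [n _ <-]; rewrite /u -normr_id; apply: uM; exists n.
have /choice[Y YE] n : exists Y : {mfun T >-> R}, Y =1 (fun w => sups (u w) n).
  apply: mfun_ex; apply: (measurable_fun_sups (h := fun k w => u w k)) => //.
  by move=> k; exact: (measurable_funP (mabs (f_ k - f))).
exists (fun n => \pi_(L0 PP) (Y n)); split.
- move=> m n mn; apply/pi_le/qsT => w; rewrite !YE.
  exact: nonincreasing_sups.
- have uY w m : u w m <= Y m w.
    rewrite YE; apply: ub_le_sup; last by exists m => /=.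
    exact: has_ubound_sdrop.
  apply/L0_infimum0; split=> [n|h hY].
    by apply: qsT => w; exact: (le_trans (normr_ge0 _) (uY w n)).
  apply: qs_imply (qs_forall hY) => w hw.
  have Y0 : Y n w @[n --> \oo] --> 0.
    by under eq_fun do rewrite YE; exact: (cvg_sups (u0 w)).
  rewrite -(cvg_lim _ Y0)//; apply: limr_ge; last exact: nearW.
  by apply/cvg_ex; exists 0.
- move=> n; apply/L0_dist_le/qsT => w; rewrite YE.
  apply: ub_le_sup; last by exists n => /=.
  exact: has_ubound_sdrop.
Qed.

(** Trades convergence under a single [Q] for convergence at every point, at the price of replacing
    [X] by a function that agrees with it only [Q]-a.s. *)
Lemma solid_local_limit C (solidC : solid C) (Q : probability T R)
    (PcQ : Pc PP Q) (X_ : nat -> L0 PP) (X : L0 PP) :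
  (forall n, C (X_ n)) -> cvg_in_probability Q X_ X ->
  exists (f_ : nat -> {mfun T >-> R}) f,
    [/\ forall n, C (\pi_(L0 PP) (f_ n)),
        forall w, f_ n w @[n --> \oo] --> f w & j Q X = j Q (\pi_(L0 PP) f)].
Proof.
move=> CX XX; have [s [N [mN N0] sN]] := ae_cvg_subsequence XX.
have mNC : measurable (~` N) by exact: measurableC.
exists (fun n => trunc mNC (repr (X_ (s n)))), (trunc mNC (repr X)); split.
- by move=> n; apply: trunc_solid => //; rewrite reprK.
(* On [N] the truncated sequence and its limit are all 0. *)
- move=> w; have [Nw|nNw] := pselect (N w).
    under eq_fun do rewrite truncE memNset ?setCK//.
    by rewrite truncE memNset ?setCK//; exact: cvg_cst.
  under eq_fun do rewrite truncE mem_set//.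
  by rewrite truncE mem_set//; exact: sN.
- rewrite j_pi//; apply/pi_eqP; exists N; first by apply/polarP; split=> // _ ->.
  by move=> w nN; rewrite truncE mem_set.
Qed.

End quasi_sure.

(** * Order convergence under [j Q] *)

Section quotient_map.
Context d (T : measurableType d) (R : realType) (PP : set (probability T R)).

(** The difficulty is the infimum, since a lower bound in [L0Q Q] holds only [Q]-a.s. The pointwise
    infimum [g] of the dominating sequence is a q.s. lower bound, so [g <= 0] q.s. and hence
    [Q]-a.s.; every [Q]-a.s. lower bound is at most [g]. *)
Lemma order_cvg_j (Q : probability T R) (PcQ : Pc PP Q) (X_ : nat -> L0 PP)
    (X : L0 PP) :
  order_cvg (fun m n => (m <= n)%N) X_ X ->
  order_cvg (fun m n => (m <= n)%N) (fun n => j Q (X_ n)) (j Q X).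
Proof.
move=> [Y [Ydec Yinf XY]]; exists (fun n => j Q (Y n)); split.
- by move=> m n /Ydec /L0_leP YY; apply/pi_le; exact: qs_ae YY.
- have YE : Y = fun n => \pi_(L0 PP) (repr (Y n)).
    by apply/funext => n; rewrite reprK.
  move: Yinf; rewrite {1}YE => /(L0_infimum0 _ (fun n => repr (Y n)))[Y0 Yle0].
  apply/(L0_infimum0 _ (fun n => repr (Y n))).
  split=> [n|h hY]; first exact: qs_ae (Y0 n).
  (* As [Y n >= 0] holds only q.s., the maximum with 0 bounds the sequence below at every point. *)
  pose u w n := Num.max (repr (Y n) w) 0.
  have lbu w : has_lbound (range (u w)).
    by exists 0 => _ [n _ <-]; rewrite /u le_max lexx orbT.
  have [g gE] : exists g : {mfun T >-> R}, g =1 (fun w => infs (u w) 0).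
    apply: mfun_ex; apply: (measurable_fun_infs (h := fun k w => u w k)) => //.
    by move=> k; apply: measurable_maxr => //; exact: measurable_cst.
  have g0 : qs PP (fun w => g w <= 0).
    apply: Yle0 => n; apply: qs_imply (Y0 n) => w Yw.
    rewrite gE -[leRHS](max_idPl Yw).
    by apply: ge_inf; [exact: has_lbound_sdrop | exists n].
  apply: qs_imply (qsI (qs_ae PcQ g0) (qs_forall hY)) => w [gw hw].
  apply: le_trans gw; rewrite gE; apply: lb_le_inf; first by exists (u w 0%N), 0%N.
  by move=> _ [n _ <-]; rewrite /u le_max hw.
- move=> n; apply/L0_dist_le; apply: (qs_ae PcQ).
  by apply/(L0_dist_le PP); rewrite !reprK.
Qed.

End quotient_map.

(** * Order convergence of nets and convergence in probability *)

Section order_vs_probability.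
Context d (T : measurableType d) (R : realType) (Q : probability T R).

Lemma le_measure_qs (A B : set T) : measurable A -> measurable B ->
  qs [set Q] (fun w => A w -> B w) -> (Q A <= Q B)%E.
Proof.
move=> mA mB [N /polarP[mN N0] AB].
rewrite -[leRHS]adde0 -(N0 Q erefl).
apply: le_trans (measureU2 _ mB mN); apply: le_measure; rewrite ?inE//.
  exact: measurableU.
by move=> w Aw; have [Nw|/AB/(_ Aw)] := pselect (N w); [right|left].
Qed.

(* With s the infimum of the masses Q (B a), B a = {Y a >= e}, pick a_ n with
   Q (B (a_ n)) < s + 2^-(n+1). By directedness Q (B (a_ n) \ B a) <= 2^-(n+1)
   for every a, so by Borel-Cantelli A = limsup B (a_ n) is Q-a.s. contained in
   every B a. Thus e times the indicator of A is below all the Y a, which forces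
   s <= Q A = 0. *)
Lemma directed_inf0_measure (I : Type) (leI : I -> I -> Prop)
    (Y : I -> {mfun T >-> R}) (e : R) :
  directed leI ->
  (forall a b, leI a b -> qs [set Q] (fun w => Y b w <= Y a w)) ->
  (forall a, qs [set Q] (fun w => 0 <= Y a w)) ->
  (forall h : {mfun T >-> R}, (forall a, qs [set Q] (fun w => h w <= Y a w)) ->
    qs [set Q] (fun w => h w <= 0)) ->
  0 < e -> forall r : R, 0 < r -> exists a, (Q [set w | (e <= Y a w)%R] < r%:E)%E.
Proof.
move=> [[i0] leIxx _ leI2] Ydec Y0 Yle0 e0.
pose B a := [set w | e <= Y a w].
have mB a : measurable (B a) by exact: measurable_mfun_ge.
pose s := ereal_inf (range (Q \o B)).
have s_le a : (s <= Q (B a))%E by apply: ereal_inf_lbound; exists a.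
have s0 : (0 <= s)%E by apply/ereal_infP => _ [a _ <-]; exact: measure_ge0.
have sfin : s \is a fin_num.
  rewrite ge0_fin_numE//; apply: le_lt_trans (s_le i0) _.
  exact: le_lt_trans (probability_le1 _ (mB i0)) (ltry _).
suff seq0 : s = 0%E.
  move=> r r0; have [_ [a _ <-]] := lb_ereal_inf_adherent r0 sfin.
  by rewrite -/s seq0 add0e; exists a.
have /choice[a_ a_P] (n : nat) :
    exists a, (Q (B a) < s + (1 / (2 ^ (n + 1))%:R)%:E)%E.
  have p0 : (0 : R) < 1 / (2 ^ (n + 1))%:R by rewrite divr_gt0// ltr0n expn_gt0.
  by have [_ [a _ <-]] := lb_ereal_inf_adherent p0 sfin; exists a.
have diff n a : (Q (B (a_ n) `\` B a) <= (1 / (2 ^ (n + 1))%:R)%:E)%E.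
  (* As [c] dominates both indices, [B c] is [Q]-a.s. inside [B (a_ n)] and [B a], whose
     intersection thus has mass at least [s]. *)
  have [c ac bc] := leI2 (a_ n) a.
  rewrite measureD//; last exact: le_lt_trans (probability_le1 _ (mB _)) (ltry _).
  rewrite leeBlDr; last by rewrite fin_num_measure//; exact: measurableI.
  apply: le_trans (ltW (a_P n)) _; rewrite addeC leeD2l//.
  apply: le_trans (s_le c) _.
  apply: le_measure_qs => //; first exact: measurableI.
  apply: qs_imply (qsI (Ydec _ _ ac) (Ydec _ _ bc)) => w [ca cb] Bc.
  by split; rewrite /B/=; [exact: le_trans ca|exact: le_trans cb].
pose A := lim_sup_set (B \o a_).
have mA : measurable A.
  by apply: measurable_lim_sup_set => n; exact: mB.
have AB a : Q (A `\` B a) = 0%E.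
  apply/eqP; rewrite eq_le measure_ge0 andbT.
  have <- : Q (lim_sup_set (fun n => B (a_ n) `\` B a)) = 0%E.
    by apply: lim_sup_set_half0 => n; [exact: measurableD|exact: diff].
  apply: le_measure; rewrite ?inE; first exact: measurableD.
    by apply: measurable_lim_sup_set => n; exact: measurableD.
  by move=> w [Aw nBw] n _; have [k nk Bk] := Aw n Logic.I; exists k.
have [h hE] :
    exists h : {mfun T >-> R}, h =1 (fun w => if w \in A then e else 0).
  by exists (trunc mA (cst e)) => w; rewrite truncE.
have QA0 : Q A = 0%E.
  apply/eqP; rewrite eq_le measure_ge0 andbT -[leRHS](measure0 Q).
  apply: le_measure_qs => //.
  have : qs [set Q] (fun w => h w <= 0).
    apply: Yle0 => a.
    have AB0 : qs [set Q] (fun w => ~ (A `\` B a) w).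
      exists (A `\` B a) => //; apply/polarP; split; first exact: measurableD.
      by move=> _ ->; exact: AB.
    apply: qs_imply (qsI AB0 (Y0 a)) => w [nAB Yw]; rewrite hE.
    case: ifPn => // /set_mem Aw; apply: contrapT => /negP nB.
    by apply: nAB; split => //; rewrite /B/= => eY; rewrite eY in nB.
  apply: qs_imply => w; rewrite hE => + Aw; rewrite mem_set// => e_le0.
  by have := lt_le_trans e0 e_le0; rewrite ltxx.
(* Each tail union of the [B (a_ n)] has mass at least [s], and these masses tend to [Q A]. *)
apply/eqP; rewrite eq_le s0 andbT -QA0.
have Hcvg := @probability_lim_sup_set_cvg _ _ _ Q _ (fun n => mB (a_ n)).
rewrite -(cvg_lim _ Hcvg)//; apply: lime_ge; first by apply/cvg_ex; exists (Q A).
apply: nearW => n; apply: le_trans (s_le (a_ n)) _.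
apply: le_measure; rewrite ?inE; first exact: mB.
  by apply: bigcup_measurable => k _; exact: mB.
by move=> w Bw; exists n => /=.
Qed.

(** Indices [a_ n] with [Q (Y (a_ n) >= 1/(n+1)) < 1/(n+1)] extract from the net a sequence
    converging to [X] in [Q]-probability. *)
Lemma closed_in_probability_order_closed (D : set (L0Q Q)) :
  closed_in_probability [set Q] D -> order_closed D.
Proof.
move=> Dcl I leI X_ X dirI DX [Y [Ydec [lb0 glb] XY]].
have Y0 a : qs [set Q] (fun w => 0 <= repr (Y a) w).
  by apply/L0_pi_ge0; rewrite reprK; apply: lb0; exists a.
have /choice[a_ a_P] (n : nat) : exists a,
    (Q [set w | (n.+1%:R^-1 <= repr (Y a) w)%R] < (n.+1%:R^-1)%:E)%E.
  have p0 : (0 : R) < n.+1%:R^-1 by rewrite invr_gt0.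
  apply: (directed_inf0_measure dirI) => //.
  - by move=> a b /Ydec /L0_leP.
  - move=> h hY; apply/L0_pi_le0/glb => _ [a _ <-].
    by rewrite -[Y a]reprK; apply/pi_le.
apply: (Dcl (X_ \o a_)) => [n|_ -> e e0]; first exact: DX.
have Hinv : (n.+1%:R^-1)%:E @[n --> \oo] --> (0%R : R)%:E.
  by apply: cvg_EFin; [exact: nearW|exact: cvg_harmonic].
apply: (squeeze_cvge _ (cvg_cst 0%E) Hinv).
(* Once 1/(n+1) < [e], a deviation of at least [e] forces [Y (a_ n) >= 1/(n+1)] [Q]-a.s. *)
near=> n; rewrite measure_ge0/=; apply: le_trans (ltW (a_P n)).
apply: le_measure_qs; [exact: measurable_mfun_dist_ge|exact: measurable_mfun_ge|].
have : qs [set Q] (fun w => `|repr (X_ (a_ n)) w - repr X w| <=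
    repr (Y (a_ n)) w).
  apply/(L0_dist_le [set Q] (repr (X_ (a_ n))) (repr X) (repr (Y (a_ n)))).
  by rewrite !reprK.
apply: qs_imply => w dw /= ew; apply: le_trans dw; apply: le_trans ew.
by apply: ltW; near: n; exact: near_infty_natSinv_lt (PosNum e0).
Unshelve. all: by end_near. Qed.

(** Makes the results on representatives applicable to [L0Q Q] itself. *)
Lemma Pc_set1 : Pc [set Q] Q.
Proof. by move=> N /polarP[_]; exact. Qed.

End order_vs_probability.

(** * Equivalence of the closedness conditions *)

Lemma directed_nat : directed (fun m n : nat => (m <= n)%N).
Proof.
split=> [|n|m n p|m n]; [exact: (inhabits 0%N)|exact: leqnn|exact: leq_trans|].
by exists (maxn m n); [exact: leq_maxl|exact: leq_maxr].
Qed.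

Theorem theorem4p8 (d : measure_display) (T : measurableType d) (R : realType)
    (PP : set (probability T R)) (PP0 : PP !=set0)
    (C : set (L0 PP)) (solidC : solid C) (sensitiveC : sensitive C)
    (QQ : set (probability T R)) (redQ : reduction_set QQ C) :
  [<-> seq_order_closed C;
       closed_in_probability QQ C;
       forall Q, QQ Q -> locally_closed Q C;
       forall Q, QQ Q -> closed_in_probability [set Q] (j Q @` C);
       forall Q, QQ Q -> order_closed (j Q @` C);
       forall Q, QQ Q -> seq_order_closed (j Q @` C)].
Proof.
have [_ QQc redC] := redQ.
have C_of_j X : (forall Q, QQ Q -> (j Q @` C) (j Q X)) -> C X.
  by move=> jX; rewrite redC => Q QQQ; exact: jX.
tfae.
- move=> Ccl X_ X CX XX; apply: C_of_j => Q QQQ.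
  (* The function [f] depends on [Q]; it is a witness for this [Q] only. *)
  have [f_ [f [Cf ff ->]]] := solid_local_limit solidC (QQc _ QQQ) CX (XX _ QQQ).
  by exists (\pi_(L0 PP) f) => //; apply: Ccl Cf _; exact: pointwise_order_cvg.
- move=> Ccl Q QQQ X_ X CX XX.
  have [f_ [f [Cf ff jX]]] := solid_local_limit solidC (QQc _ QQQ) CX XX.
  exists (\pi_(L0 PP) f) => //; apply: Ccl Cf _ => Q' QQQ'.
  apply/cvg_in_probability_pi; first exact: QQc.
  exact: pointwise_cvg_in_probability.
- move=> Ccl Q QQQ X_ X CX /(_ Q erefl) XX.
  have /choice[Z_ /all_and2[CZ ZX]] n : exists Z, C Z /\ j Q Z = X_ n.
    by have [Z ? ?] := CX n; exists Z.
  (* A representative of a [Q]-class also defines a q.s. class, so [X] lifts along [j Q]. *)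
  have jrepr : j Q (\pi_(L0 PP) (repr X)) = X.
    by rewrite j_pi ?reprK//; exact: QQc.
  have [|Y CY jY] := Ccl Q QQQ Z_ (\pi_(L0 PP) (repr X)) CZ; last first.
    by exists Y => //; rewrite -jY jrepr.
  (* Both sequences are written through the functions [repr (Z_ n)], so that convergence in
     [Q]-probability passes between the two quotients. *)
  have XE : X_ = fun n => \pi_(L0Q Q) (repr (Z_ n)).
    by apply/funext => n; rewrite -ZX.
  have ZE : Z_ = fun n => \pi_(L0 PP) (repr (Z_ n)).
    by apply/funext => n; rewrite reprK.
  have := XX; rewrite {1}XE -{1}[X]reprK.
  move=> /(cvg_in_probability_pi (fun n => repr (Z_ n)) (repr X)
    (@Pc_set1 _ _ _ Q)) reprZX.
  rewrite {1}ZE.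
  apply/(cvg_in_probability_pi (fun n => repr (Z_ n)) (repr X) (QQc _ QQQ)).
  exact: reprZX.
- by move=> Ccl Q QQQ; apply: closed_in_probability_order_closed; exact: Ccl.
- move=> Ccl Q QQQ X_ X; exact (Ccl Q QQQ _ _ X_ X directed_nat).
- move=> Ccl X_ X CX XX; apply: C_of_j => Q QQQ.
  apply: (Ccl Q QQQ (fun n => j Q (X_ n))); first by move=> n; exists (X_ n).
  by apply: order_cvg_j => //; exact: QQc.
Qed.
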